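(* Let $q$ be a prime power with $q-1>2$ and let $b$ be an integer with $1\le b\le q$. Suppose that the code $C(q-1,0,b)$ belongs to group (G3), i.e. $$q^2-q-2\le (q-1)(q+1)-b\le (q^2-q-2)+q$$ and the divisor $(q-1)(q+1)P_\infty-bP_0$ on $X$ is linearly equivalent to an integer multiple of $P_\infty$ or to an integer multiple of $P_0$. Then the minimum distance of the dual code $C(q-1,0,b)^\perp$ is $q$. Moreover, let $\{P_1,\dots,P_q\}\subseteq B$ be the support of a minimum-weight codeword of $C(q-1,0,b)^\perp$. Then $P_1,\dots,P_q$ are collinear, and if $b\le q-1$, then $P_0,P_1,\dots,P_q$ are collinear.
   Context: Let $q$ be a prime power, $\mathbb{P}^2$ the projective plane over $\mathbb{F}_{q^2}$ with coordinates $(x:y:z)$, and $X\subseteq\mathbb{P}^2$ the Hermitian curve, with affine equation $y^q+y=x^{q+1}$; it is a smooth plane curve of degree $q+1$ with $q^3+1$ $\mathbb{F}_{q^2}$-rational points, and its canonical divisors have degree $q^2-q-2$. Let $P_\infty=(0:1:0)$ and $P_0=(0:0:1)$, both in $X(\mathbb{F}_{q^2})$, and $B:=X(\mathbb{F}_{q^2})\setminus\{P_\infty,P_0\}$. For integers $d>0$ and $0\le a,b\le q$, let $E:=aP_\infty+bP_0$, viewed as a zero-dimensional subscheme of $\mathbb{P}^2$, and let $C(d,a,b)\subseteq\mathbb{F}_{q^2}^{\,|B|}$ be the linear code obtained by evaluating the vector space $H^0(X,\mathcal{O}_X(d)(-E))$ at the points of $B$. Equivalently, one evaluates the homogeneous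 forms of degree $d$ over $\mathbb{F}_{q^2}$ that vanish on the scheme $E$ at fixed coordinate representatives of the points of $B$; a different choice of representatives multiplies the code coordinatewise by a vector with nonzero entries, which changes neither the minimum distance of the dual code nor the supports of its codewords. $C^\perp$ denotes the dual code, and the support of a codeword is identified with the corresponding subset of $B$. Minimum-weight codewords are nonzero codewords of minimum Hamming weight. *)

(* Defs.v *)
From HB Require Import structures.
From mathcomp Require Export all_boot all_order all_algebra.
From mathcomp Require Export closed_field.
From mathcomp Require Export mpoly freeg.

Set Implicit Arguments.
Unset Strict Implicit.
Unset Printing Implicit Defensive.

Import Order.TTheory GRing.Theory Num.Theory.
Local Open Scope ring_scope.

Definition prime_power (q : nat) : Prop :=
  exists p k, [/\ prime p, (0 < k)%N & q = (p ^ k)%N].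

(* A point of P^2(K) is given by its unique representative (x, y, z) whose last
   nonzero coordinate is 1; in particular the affine point (x, y) is (x, y, 1).
   These are also the representatives at which forms are evaluated below. *)
Definition normalized (K : fieldType) (v : 'rV[K]_3) : bool :=
  [exists i, (v 0 i == 1) && [forall j : 'I_3, (i < j)%N ==> (v 0 j == 0)]].

Record ppoint (K : fieldType) : Type :=
  PPoint { pcoord :> 'rV[K]_3; _ : normalized pcoord }.

HB.instance Definition _ (K : fieldType) := [isSub of ppoint K for @pcoord K].
HB.instance Definition _ (K : fieldType) := [Choice of ppoint K by <:].
HB.instance Definition _ (K : countFieldType) := [Countable of ppoint K by <:].
HB.instance Definition _ (K : finFieldType) := [Finite of ppoint K by <:].

Definition ix : 'I_3 := inord 0.
Definition iy : 'I_3 := inord 1.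
Definition iz : 'I_3 := inord 2.

Lemma normalized_Pinf (K : fieldType) : normalized (delta_mx 0 iy : 'rV[K]_3).
Proof.
apply/existsP; exists iy; rewrite mxE !eqxx /=.
apply/forallP => j; apply/implyP => ltj; rewrite mxE /=.
by case: (j =P iy) ltj => [->|]; rewrite ?ltnn ?andbF ?eqxx.
Qed.

Lemma normalized_P0 (K : fieldType) : normalized (delta_mx 0 iz : 'rV[K]_3).
Proof.
apply/existsP; exists iz; rewrite mxE !eqxx /=.
apply/forallP => j; apply/implyP => ltj; rewrite mxE /=.
by case: (j =P iz) ltj => [->|]; rewrite ?ltnn ?andbF ?eqxx.
Qed.

Definition Pinf (K : fieldType) : ppoint K := PPoint (normalized_Pinf K).
Definition P0 (K : fieldType) : ppoint K := PPoint (normalized_P0 K).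

Section Forms.
Variable K : fieldType.
Implicit Types (P : ppoint K) (f g : {mpoly K[3]}).

Definition evalp f P : K := f.@[fun i => pcoord P 0 i].

(* The homogenization of y^q + y = x^(q+1). *)
Definition hermitian (q : nat) : {mpoly K[3]} :=
  'X_iy ^+ q * 'X_iz + 'X_iy * 'X_iz ^+ q - 'X_ix ^+ q.+1.

Definition onX (q : nat) P : bool := evalp (hermitian q) P == 0.

(* The homogeneous ideal of P: all homogeneous components vanish at P. *)
Definition point_ideal P f : Prop :=
  forall d, evalp (pihomog mdeg d f) P = 0.

Definition ideal_mul (I J : {mpoly K[3]} -> Prop) f : Prop :=
  exists s : seq ({mpoly K[3]} * {mpoly K[3]}),
    (forall u, u \in s -> I u.1 /\ J u.2) /\ f = \sum_(u <- s) u.1 * u.2.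

Definition ideal_pow (I : {mpoly K[3]} -> Prop) (n : nat) :
  {mpoly K[3]} -> Prop := iter n (ideal_mul I) (fun _ => True).

(* The form f vanishes on the subscheme nP of the curve X: locally at P it
   belongs to (h) + I_P^n, with h the equation of X and I_P the ideal of P,
   i.e. it does so up to a homogeneous multiplier a with a(P) <> 0. *)
Definition vanishes_on (q : nat) P (n : nat) f : Prop :=
  exists (k : nat) (a c r : {mpoly K[3]}),
    [/\ a \is k.-homog, evalp a P != 0, ideal_pow (point_ideal P) n r
      & a * f = hermitian q * c + r].

Definition order_at (q : nat) P f (n : nat) : Prop :=
  vanishes_on q P n f /\ ~ vanishes_on q P n.+1 f.

Definition zero_on_X (q : nat) f : Prop := exists g, f = hermitian q * g.

End Forms.

Section Divisors.
Variable F : finFieldType.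

Definition Fbar : countClosedFieldType := projT1 (countable_algebraic_closure F).
Definition to_Fbar : {rmorphism F -> Fbar} :=
  sval (projT2 (countable_algebraic_closure F)).

(* Divisors on X are formal sums of geometric points of X.  D and D' are
   linearly equivalent over F when D - D' is the divisor of a nonzero rational
   function f / g on X defined over F. *)
Definition lin_equiv (q : nat) (D D' : {freeg ppoint Fbar}) : Prop :=
  exists (e : nat) (f g : {mpoly F[3]}),
    [/\ f \is e.-homog, g \is e.-homog, ~ zero_on_X q f, ~ zero_on_X q g &
      forall P : ppoint Fbar,
        if onX q P then
          exists m n : nat,
            [/\ order_at q P (map_mpoly to_Fbar f) m,
                order_at q P (map_mpoly to_Fbar g) n
              & coeff P (D - D') = m%:Z - n%:Z]
        else coeff P (D - D') = 0].

End Divisors.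

Section Codes.
Variables (F : finFieldType) (n : nat).
Implicit Types (C : 'rV[F]_n -> Prop) (c : 'rV[F]_n).

Definition dual_code C c : Prop :=
  forall w, C w -> \sum_i c 0 i * w 0 i = 0.

Definition hamming_dist c c' : nat := #|[set i | c 0 i != c' 0 i]|.

Definition weight c : nat := #|[set i | c 0 i != 0]|.

Definition is_min_distance C (d : nat) : Prop :=
  (exists c c', [/\ C c, C c', c != c' & hamming_dist c c' = d]) /\
  (forall c c', C c -> C c' -> c != c' -> (d <= hamming_dist c c')%N).

Definition min_weight_codeword C c : Prop :=
  [/\ C c, c != 0 & forall c', C c' -> c' != 0 -> (weight c <= weight c')%N].

End Codes.

Section HermitianCode.
Variables (F : finFieldType) (q : nat).

Definition Bset : {set ppoint F} := [set P | onX q P] :\: [set Pinf F; P0 F].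

Definition hermitian_code (d a b : nat) (w : 'rV[F]_#|Bset|) : Prop :=
  exists f : {mpoly F[3]},
    [/\ f \is d.-homog, vanishes_on q (Pinf F) a f, vanishes_on q (P0 F) b f
      & w = \row_i evalp f (enum_val i)].

Definition code_support (c : 'rV[F]_#|Bset|) : {set ppoint F} :=
  [set enum_val i | i in [set i : 'I_#|Bset| | c 0 i != 0]].

Definition collinear (S : {set ppoint F}) : Prop :=
  exists2 l : 'rV[F]_3, l != 0 &
    forall P : ppoint F, P \in S -> \sum_i l 0 i * pcoord P 0 i = 0.

End HermitianCode.

(* Main.v *)
Require Import Defs.
From mathcomp Require Import finfield ring zify.

(** The argument uses only products of lines.

    The tangent line to the curve at [P0] is [y = 0]; it meets the curve at [P0]
    with multiplicity [q + 1] and nowhere else.  Hence for [b <= q] the form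
    [y * g] lies in the space defining the code for every form [g] of degree
    [q - 2] ([vanishes_on_tangent]), and a word of the dual code also gives, up
    to the nonzero factors [y P], a linear relation between the values of all
    forms of degree [q - 2] at the points [P] of its support [S].  So no form of
    degree [q - 2] can vanish at all points of [S] but one
    ([dual_isolated_degree_q_minus_2]).

    If [S] had fewer than [q] points, a product of at most [q - 2] lines would do
    exactly that ([dual_weight_ge]).  If [S] has [q] points that are not
    collinear, then some line passes through two points of [S] and misses a
    third point [P]; with one further line for each of the other [q - 3]
    points this isolates [P] again ([support_collinear]).

    If [b <= q - 1] and the line containing [S] misses [P0], fix [P] in [S]: the
    [q - 1] lines joining [P0] to the other points of [S] all miss [P].  Their
    product has degree [q - 1] and multiplicity [q - 1 >= b] at [P0], so it
    belongs to the space defining the code and isolates [P], which is impossible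
    ([support_collinear_P0]).

    Finally, weight [q] is attained on the line [x = y] through [P0].  Its
    other intersections with the curve are [(1/u : 1/u : 1)] with
    [u ^ q + u = 1], an equation with [q] roots in the field ([trace_one_roots]).
    Along this line the forms of the code are polynomials of degree at most
    [q - 1] that vanish at the origin, a space of dimension [q - 1], so their
    values at these [q] points are linearly dependent ([dual_word_on_secant]). *)

Set Implicit Arguments.
Unset Strict Implicit.
Unset Printing Implicit Defensive.

Import Order.TTheory GRing.Theory Num.Theory.
Local Open Scope ring_scope.

(** * Points and lines of the plane *)

Lemma left_kernel_nontrivial (K : fieldType) n m (A : 'M[K]_(n, m)) :
  (m < n)%N -> exists2 c : 'rV[K]_n, c != 0 & c *m A = 0.
Proof.
move=> lt_mn; have /rowV0Pn[c /sub_kermxP cA c0] : kermx A != 0.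
  rewrite kermx_eq0 /row_free neq_ltn.
  by rewrite (leq_ltn_trans (rank_leq_col A) lt_mn).
by exists c.
Qed.

Section Plane.
Variable K : fieldType.
Implicit Types (P Q R : ppoint K) (f g l : {mpoly K[3]}).

Lemma sum_xyz (V : nmodType) (u : 'I_3 -> V) :
  \sum_i u i = u ix + u iy + u iz.
Proof.
rewrite !big_ord_recl big_ord0 addr0 addrA.
by congr (u _ + u _ + u _); apply: val_inj; rewrite /= inordK.
Qed.

Lemma xyzP (Z : 'I_3 -> Prop) : Z ix -> Z iy -> Z iz -> forall i, Z i.
Proof.
move=> Zx Zy Zz i; have: [|| i == ix, i == iy | i == iz].
  by rewrite -!val_eqE /= !inordK //; case: i => [[|[|[]]]].
by case/or3P => /eqP ->.
Qed.

Lemma xyz_neq : (ix == iy = false) * (ix == iz = false) * (iy == iz = false)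
  * (iy == ix = false) * (iz == ix = false) * (iz == iy = false).
Proof. by rewrite -!val_eqE /= !inordK. Qed.

Lemma evalpM f g P : evalp (f * g) P = evalp f P * evalp g P.
Proof. exact: mevalM. Qed.

Lemma evalpD f g P : evalp (f + g) P = evalp f P + evalp g P.
Proof. exact: mevalD. Qed.

Lemma evalpXn f n P : evalp (f ^+ n) P = evalp f P ^+ n.
Proof. exact: rmorphXn. Qed.

Lemma evalpX i P : evalp 'X_i P = pcoord P 0 i.
Proof. exact: mevalXU. Qed.

Lemma evalp_hermitian q P : evalp (hermitian K q) P =
  pcoord P 0 iy ^+ q * pcoord P 0 iz + pcoord P 0 iy * pcoord P 0 iz ^+ q
  - pcoord P 0 ix ^+ q.+1.
Proof.
by rewrite {1}/evalp /hermitian mevalB mevalD !mevalM !rmorphXn /= !mevalXU.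
Qed.

Lemma homogX i : ('X_i : {mpoly K[3]}) \is 1.-homog.
Proof. by rewrite dhomogX /= mdeg1. Qed.

Lemma homogXn i n : ('X_i ^+ n : {mpoly K[3]}) \is n.-homog.
Proof. by have := dhomogMn n (homogX i); rewrite mul1n. Qed.

Definition lform (v : 'rV[K]_3) : {mpoly K[3]} := \sum_i v 0 i *: 'X_i.

Lemma lform_homog v : lform v \is 1.-homog.
Proof. by apply: rpred_sum => i _; apply/dhomogZ/homogX. Qed.

Lemma evalp_lform v P : evalp (lform v) P = \sum_i v 0 i * pcoord P 0 i.
Proof.
rewrite /evalp /lform raddf_sum; apply: eq_bigr => i _ /=.
by rewrite mevalZ mevalXU.
Qed.

Lemma line_through P Q : exists2 v : 'rV[K]_3, v != 0 &
  evalp (lform v) P = 0 /\ evalp (lform v) Q = 0.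
Proof.
pose A : 'M[K]_(3, 2) :=
  \matrix_(i, j) if j == ord0 then pcoord P 0 i else pcoord Q 0 i.
have [//|v v0 vA] := left_kernel_nontrivial A; exists v => //.
have vAj j : \sum_i v 0 i * A i j = 0.
  by move: (congr1 (fun B : 'rV_2 => B 0 j) vA); rewrite !mxE.
rewrite !evalp_lform -[RHS](vAj ord0) -[X in _ /\ _ = X](vAj ord_max).
by split; apply: eq_bigr => i _; rewrite mxE.
Qed.

(** The 2 x 2 minors of two distinct normalized vectors do not all vanish, and
    each of them is a linear form in the first vector that kills the second. *)
Lemma separating_line P Q : P != Q ->
  exists l, [/\ l \is 1.-homog, evalp l Q = 0 & evalp l P != 0].
Proof.
move=> neqPQ; pose u : 'rV[K]_3 := P; pose w : 'rV[K]_3 := Q.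
suff [i [k minor0]] : exists i k, u 0 k * w 0 i - u 0 i * w 0 k != 0.
  exists (w 0 i *: 'X_k - w 0 k *: 'X_i); split.
  - by rewrite rpredB // dhomogZ // homogX.
  - by rewrite /evalp mevalB !mevalZ !mevalXU mulrC subrr.
  - by rewrite /evalp mevalB !mevalZ !mevalXU mulrC [w 0 k * _]mulrC.
have /existsP[i /andP[/eqP ui /forallP uj]] : normalized u by exact: valP P.
have /existsP[j /andP[/eqP wj /forallP wi]] : normalized w by exact: valP Q.
have [lt_ij | lt_ji | /ord_inj eq_ij] := ltngtP i j.
- have /eqP uj0 := implyP (uj j) lt_ij.
  by exists j, i; rewrite ui wj uj0 mul0r subr0 mulr1 oner_neq0.
- have /eqP wi0 := implyP (wi i) lt_ji.
  by exists i, j; rewrite ui wj wi0 mulr0 sub0r mul1r oppr_eq0 oner_neq0.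
- subst j; have /eqP/rowP : P != Q :> 'rV_3 by [].
  have [/existsP[k uwk] _ | /existsPn eq_uw []] :=
    boolP [exists k, u 0 k != w 0 k].
    by exists i, k; rewrite ui wj mulr1 mul1r subr_eq0.
  by move=> k; apply/eqP; move: (eq_uw k); rewrite negbK.
Qed.

(** In the pencil of lines through [Q] that contains a line missing [P] and the
    line [PQ], exactly one member passes through [R]; it is not [PQ]. *)
Lemma line_avoiding P Q R l : P != Q ->
  l \is 1.-homog -> evalp l P = 0 -> evalp l Q = 0 -> evalp l R != 0 ->
  exists m, [/\ m \is 1.-homog, evalp m Q = 0, evalp m R = 0 & evalp m P != 0].
Proof.
move=> neqPQ l1 lP lQ lR; have [k [k1 kQ kP]] := separating_line neqPQ.
pose c := evalp k R / evalp l R; exists (k - c *: l).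
have E T : evalp (k - c *: l) T = evalp k T - c * evalp l T.
  by rewrite /evalp mevalB mevalZ.
split; rewrite ?E ?lP ?lQ ?kQ ?mulr0 ?subr0 //.
  by rewrite rpredB // dhomogZ.
by rewrite /c divfK // subrr.
Qed.

(** One line through each point of [s] that misses [P]. *)
Lemma separating_form P (s : seq (ppoint K)) : P \notin s ->
  exists f, [/\ f \is (size s).-homog, forall Q, Q \in s -> evalp f Q = 0
    & evalp f P != 0].
Proof.
elim: s => [_|Q s IHs].
  by exists 1; rewrite dhomog1 /evalp meval1 oner_neq0.
rewrite inE negb_or => /andP[/separating_line[l [l1 lQ lP]] /IHs].
case=> f [fh fs fP]; exists (l * f); split.
- exact: (dhomogM l1 fh).
- by move=> R; rewrite inE evalpM => /orP[/eqP->|/fs ->];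
    rewrite ?lQ ?mul0r ?mulr0.
- by rewrite evalpM mulf_neq0.
Qed.

(** * Vanishing orders along the curve *)

Lemma homog1_point_ideal P l :
  l \is 1.-homog -> evalp l P = 0 -> point_ideal P l.
Proof.
move=> l1 lP [|[|d]]; first by rewrite (pihomog_ne0 _ l1) // /evalp meval0.
  by rewrite pihomog_dE.
by rewrite (pihomog_ne0 _ l1) // /evalp meval0.
Qed.

Lemma point_ideal_eval P f : point_ideal P f -> evalp f P = 0.
Proof.
move=> IPf; rewrite (pihomog_partitionE (leqnn (mmeasure mdeg f))).
by rewrite /evalp raddf_sum big1 // => d _; exact: IPf.
Qed.

Lemma ideal_pow_mulS (I : {mpoly K[3]} -> Prop) n f g :
  I f -> ideal_pow I n g -> ideal_pow I n.+1 (f * g).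
Proof.
move=> If Ig; exists [:: (f, g)]; rewrite big_seq1; split=> // u.
by rewrite inE => /eqP->.
Qed.

Lemma ideal_pow_exp (I : {mpoly K[3]} -> Prop) m n f g :
  (n <= m)%N -> I f -> ideal_pow I n (f ^+ m * g).
Proof.
move=> le_nm If; elim: n m le_nm => // n IHn [//|m] le_nm.
by rewrite exprS -mulrA; apply/ideal_pow_mulS/IHn.
Qed.

Lemma ideal_pow_eval P n f :
  (0 < n)%N -> ideal_pow (point_ideal P) n f -> evalp f P = 0.
Proof.
case: n => // n _ [s [Is ->]]; rewrite /evalp raddf_sum big_seq big1 //= => u.
by case/Is => /point_ideal_eval uP _; rewrite -/(evalp _ _) evalpM uP mul0r.
Qed.

Lemma vanishes_on0 q P f : vanishes_on q P 0 f.
Proof.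
exists 0%N, 1, 0, f; rewrite dhomog1 /evalp meval1 oner_neq0 mulr0 add0r mul1r.
by split.
Qed.

Lemma vanishes_on_eval q P n f : (0 < n)%N -> onX q P ->
  vanishes_on q P n f -> evalp f P = 0.
Proof.
move=> n0 /eqP hP [k [a [c [r [_ aP /(ideal_pow_eval n0) rP]]]]].
move/(congr1 (fun g => evalp g P)); rewrite evalpD !evalpM hP rP mul0r addr0.
by move/eqP; rewrite mulf_eq0 (negPf aP) => /eqP.
Qed.

Lemma ideal_pow_vanishes_on q P n f :
  ideal_pow (point_ideal P) n f -> vanishes_on q P n f.
Proof.
move=> If; exists 0%N, 1, 0, f.
by rewrite dhomog1 /evalp meval1 oner_neq0 mulr0 add0r mul1r.
Qed.

(** When the lines through the points of [s] can all be chosen through a common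
    point [R], their product is a cone with vertex [R], which vanishes there to
    an order equal to its degree. *)
Lemma separating_cone P R s :
  (forall Q, Q \in s -> exists m,
    [/\ m \is 1.-homog, evalp m Q = 0, evalp m R = 0 & evalp m P != 0]) ->
  exists f, [/\ f \is (size s).-homog, forall Q, Q \in s -> evalp f Q = 0,
    evalp f P != 0
    & forall n, (n <= size s)%N -> ideal_pow (point_ideal R) n f].
Proof.
elim: s => [_|Q s IHs sepP].
  by exists 1; rewrite dhomog1 /evalp meval1 oner_neq0; split=> // [[]].
have [l [l1 lQ lR lP]] := sepP Q (mem_head _ _).
case: IHs => [T sT|f [fh fs fP fI]]; first by apply: sepP; rewrite inE sT orbT.
exists (l * f); split.
- exact: (dhomogM l1 fh).
- by move=> T; rewrite inE evalpM => /orP[/eqP->|/fs ->];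
    rewrite ?lQ ?mul0r ?mulr0.
- by rewrite evalpM mulf_neq0.
- by case=> // n /fI; apply/ideal_pow_mulS/homog1_point_ideal.
Qed.

(** On the curve, [y * (z ^ q + y ^ (q - 1) * z) = x ^ (q + 1)], and the second
    factor does not vanish at [P0] when [q > 1]: the tangent line [y = 0] meets
    the curve at [P0] with multiplicity [q + 1]. *)
Lemma vanishes_on_tangent q b g : (1 < q)%N -> (b <= q.+1)%N ->
  vanishes_on q (P0 K) b ('X_iy * g).
Proof.
case: q => // q lt1q le_bq.
exists q.+1, ('X_iz ^+ q.+1 + 'X_iy ^+ q * 'X_iz), g, ('X_ix ^+ q.+2 * g).
split.
- rewrite rpredD ?homogXn //.
  by have := dhomogM (homogXn iy q) (homogX iz); rewrite addn1.
- rewrite evalpD evalpM !evalpXn !evalpX !mxE !eqxx /= xyz_neq.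
  by rewrite mulr1 expr1n expr0n eqn0Ngt -ltnS lt1q addr0 oner_neq0.
- apply: ideal_pow_exp => //; apply: homog1_point_ideal; first exact: homogX.
  by rewrite evalpX mxE xyz_neq andbF.
- rewrite /hermitian; move: ('X_ix) ('X_iy) ('X_iz) => x y z.
  by rewrite !exprS; ring.
Qed.

End Plane.

(** * A secant line through [P0] *)

Lemma prod_xyz (A : pzSemiRingType) (u : 'I_3 -> A) :
  \prod_i u i = u ix * u iy * u iz.
Proof.
rewrite !big_ord_recl big_ord0 mulr1 mulrA.
by congr (u _ * u _ * u _); apply: val_inj; rewrite /= inordK.
Qed.

Section Diagonal.
Variable F : finFieldType.
Implicit Types (x u : F) (f : {mpoly F[3]}).

Definition diag_row x : 'rV[F]_3 := \row_i (if i == iz then 1 else x).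

Lemma normalized_diag x : normalized (diag_row x).
Proof.
apply/existsP; exists iz; rewrite mxE !eqxx /=.
by apply/forallP; apply: xyzP; rewrite /= !inordK.
Qed.

Definition diag_pt x : ppoint F := PPoint (normalized_diag x).

Lemma diag_pt0 : diag_pt 0 = P0 F.
Proof.
by apply/val_inj/rowP; apply: xyzP; rewrite !mxE ?xyz_neq ?eqxx //= andbF.
Qed.

Lemma diag_pt_inj : injective diag_pt.
Proof.
move=> x x' /(congr1 (fun P : ppoint F => pcoord P 0 ix)).
by rewrite !mxE xyz_neq.
Qed.

(** The size of [p] is bounded by the degree of [f] because a monomial
    [x ^ i * y ^ j * z ^ k] restricts to [x ^ (i + j)]. *)
Lemma evalp_diag n f : f \is n.-homog -> exists2 p : {poly F},
  (size p <= n.+1)%N & forall x, evalp f (diag_pt x) = p.[x].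
Proof.
move=> /dhomogP homf; have fn m : m \in msupp f -> mdeg m = n := homf m.
exists (\sum_(m <- msupp f) f@_m *: 'X^(m ix + m iy)).
  apply: (leq_trans (size_sum _ _ _)); rewrite big_seq.
  elim/big_rec: _ => // m k /fn <- le_k; rewrite geq_max le_k andbT.
  rewrite (leq_trans (size_scale_leq _ _)) // size_polyXn ltnS mdegE sum_xyz.
  exact: leq_addr.
move=> x; rewrite horner_sum /evalp mevalE; apply: eq_bigr => m _.
by rewrite prod_xyz !mxE !xyz_neq eqxx expr1n mulr1 hornerZ hornerXn exprD.
Qed.

(** With [A = X ^ q + X - 1] one has [A ^ q + 1 = (X ^ q + X) ^ q], so that
    [A] divides [A ^ q - A = X ^ (q ^ 2) - X], which splits over [F] with simple
    roots. *)
Lemma trace_one_roots q : prime_power q -> #|F| = (q ^ 2)%N ->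
  exists s : seq F,
    [/\ uniq s, size s = q & forall u, u \in s -> u ^+ q + u = 1].
Proof.
case=> p [k [p_pr k0 ->]]; set q0 := (p ^ k)%N => cardF.
have charF : p \in [pchar F].
  by apply: (@card_finPcharP F p (k * 2)) => //; rewrite cardF expnM.
have charP : p \in [pchar {poly F}] by exact: rmorph_pchar polyC _ charF.
have q1 : (1 < q0)%N by rewrite -(expn0 p) ltn_exp2l ?prime_gt1.
have qnat : [pchar {poly F}].-nat q0 by rewrite pnatX pnatE ?charP.
pose A : {poly F} := 'X^q0 + 'X - 1.
have sizeA : size A = q0.+1.
  rewrite /A -addrA size_polyDl size_polyXn // -[1]/(1%:P) size_XsubC.
  by rewrite !ltnS.
have dvdA : A %| 'X^#|F| - 'X.
  apply/dvdpP; exists (A ^+ q0.-1 - 1).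
  rewrite mulrBl mul1r -exprSr prednK ?(ltnW q1) //.
  have AqE : A ^+ q0 = 'X^#|F| + 'X^q0 - 1.
    apply: (addIr 1); rewrite -{1}(expr1n _ q0) -exprDn_pchar // subrK subrK.
    by rewrite exprDn_pchar // -exprM cardF mulnn.
  by rewrite AqE /A !opprD !addrA; ring.
move: dvdA; rewrite finField_genPoly => /dvdp_prod_XsubC[m eqA].
exists (mask m (index_enum F)); split.
- by rewrite mask_uniq // index_enum_uniq.
- by move: (eqp_size eqA); rewrite sizeA size_prod_XsubC => -[->].
- move=> u; rewrite -root_prod_XsubC -(eqp_root eqA) => /rootP.
  by rewrite /A !hornerE => /eqP; rewrite subr_eq0 => /eqP.
Qed.

End Diagonal.

(** * The dual code *)

Lemma dual_sub (F : finFieldType) n (C : 'rV[F]_n -> Prop) c c' :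
  dual_code C c -> dual_code C c' -> dual_code C (c - c').
Proof.
move=> dc dc' w Cw; under eq_bigr => i _ do rewrite !mxE mulrBl.
by rewrite sumrB dc // dc' // subrr.
Qed.

Section DualCode.
Variables (F : finFieldType) (q b : nat).
Hypotheses (q2 : (2 < q - 1)%N) (b0 : (0 < b)%N) (bq : (b <= q)%N).
Local Notation B := (Bset F q).
Local Notation dual := (dual_code (@hermitian_code F q (q - 1) 0 b)).
Implicit Types (c : 'rV[F]_#|B|) (f : {mpoly F[3]}).

Lemma weight_support c : weight c = #|code_support c|.
Proof. by rewrite /weight card_imset //; apply: enum_val_inj. Qed.

Lemma mem_code_support c i : (enum_val i \in code_support c) = (c 0 i != 0).
Proof. by rewrite mem_imset ?inE //; apply: enum_val_inj. Qed.

Lemma code_supportP c P :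
  P \in code_support c -> exists2 i, P = enum_val i & c 0 i != 0.
Proof. by case/imsetP => i; rewrite inE; exists i. Qed.

Lemma code_support_B c P : P \in code_support c -> P \in B.
Proof. by case/code_supportP => i -> _; apply: enum_valP. Qed.

(** Every term of the orthogonality relation other than that of [P] vanishes,
    either because the coefficient does or because [f] does. *)
Lemma dual_isolated c f P : dual c -> f \is (q - 1).-homog ->
  vanishes_on q (P0 F) b f -> P \in code_support c ->
  (forall Q, Q \in code_support c -> Q != P -> evalp f Q = 0) ->
  evalp f P = 0.
Proof.
move=> dc fh fb /code_supportP[i -> ci] fS.
have := dc (\row_j evalp f (enum_val j)).
rewrite (bigD1 i) //= big1 => [|j neq_ji]; last first.
  rewrite mxE; have [->|cj] := eqVneq (c 0 j) 0; first by rewrite mul0r.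
  rewrite fS ?mulr0 ?mem_code_support //.
  by rewrite (inj_eq enum_val_inj).
rewrite mxE addr0 => cfP; apply/eqP; rewrite -(mulrI_eq0 _ (mulfI ci)).
by apply/eqP/cfP; exists f; split=> //; apply: vanishes_on0.
Qed.

(** On the curve, [y = 0] forces [x ^ (q + 1) = 0], so the tangent line at [P0]
    meets the curve nowhere else. *)
Lemma curve_y_neq0 P : P \in B -> pcoord P 0 iy != 0.
Proof.
rewrite !inE negb_or => /andP[/andP[_ P0n] /eqP].
rewrite evalp_hermitian => E; apply: contra_neq P0n => y0.
have x0 : pcoord P 0 ix = 0.
  move: E; rewrite y0 mul0r expr0n.
  have -> : (q == 0)%N = false by case: (q) q2.
  by rewrite mul0r addr0 sub0r => /eqP; rewrite oppr_eq0 expf_eq0 => /eqP.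
have /existsP[i /andP[/eqP Pi _]] := valP P.
apply/val_inj/rowP.
have Pz : pcoord P 0 iz = 1.
  move: Pi; move: i; apply: xyzP; rewrite //= ?x0 ?y0 => /esym/eqP;
    by rewrite oner_eq0.
by apply: xyzP; rewrite mxE ?xyz_neq ?x0 ?y0 ?Pz ?eqxx ?andbF.
Qed.

(** Multiplying by [y] turns every form of degree [q - 2] into one of the code
    without losing any of its values on the support. *)
Lemma dual_isolated_degree_q_minus_2 c g P : dual c ->
  g \is (q - 2).-homog -> P \in code_support c ->
  (forall Q, Q \in code_support c -> Q != P -> evalp g Q = 0) ->
  evalp g P = 0.
Proof.
move=> dc gh cP gS.
have yP := curve_y_neq0 (code_support_B cP).
have: evalp ('X_iy * g) P = 0.
  apply: dual_isolated dc _ _ cP _.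
  - by have := dhomogM (homogX F iy) gh; rewrite addnBA ?add1n ?subSS //; lia.
  - by apply: vanishes_on_tangent; lia.
  - by move=> Q cQ /(gS Q cQ); rewrite evalpM => ->; rewrite mulr0.
by rewrite evalpM evalpX => /eqP; rewrite mulf_eq0 (negPf yP) => /eqP.
Qed.

Lemma dual_weight_ge c : dual c -> c != 0 -> (q <= weight c)%N.
Proof.
move=> dc /rV0Pn[i ci]; rewrite weight_support leqNgt; apply/negP => lt_cq.
pose P : ppoint F := enum_val i.
have cP : P \in code_support c by rewrite mem_code_support.
have [|f [fh fS fP]] := @separating_form F P (enum (code_support c :\ P)).
  by rewrite mem_enum !inE eqxx.
have [|l [l1 _ lP]] := @separating_line F P (P0 F).
  by apply: contraTneq (code_support_B cP) => ->; rewrite !inE eqxx orbT.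
move: fh; rewrite -cardE => fh; have sz := cardsD1 P (code_support c).
rewrite cP add1n in sz.
(* The power of [l], a line missing [P], raises the degree to [q - 2]. *)
set k := #|code_support c :\ P| in fh sz.
suff: evalp (f * l ^+ (q - 2 - k)) P = 0.
  by apply/eqP; rewrite evalpM evalpXn mulf_neq0 // expf_neq0.
apply: dual_isolated_degree_q_minus_2 dc _ cP _.
  have := dhomogM fh (dhomogMn (q - 2 - k) l1); rewrite mul1n subnKC //.
  by rewrite sz in lt_cq; lia.
by move=> Q cQ neqQP; rewrite evalpM fS ?mul0r // mem_enum !inE neqQP.
Qed.

(** If the support is not on a line, the [q - 1] points other than [P] lie on
    [q - 2] lines missing [P], one of which passes through two of them. *)
Lemma support_collinear c :
  dual c -> weight c = q -> collinear (code_support c).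
Proof.
move=> dc; rewrite weight_support => wc; set S := code_support c in wc *.
have [P SP] : exists P, P \in S by apply/set0Pn; rewrite -card_gt0 wc; lia.
have szP := cardsD1 P S; rewrite SP wc add1n in szP.
have [Q SPQ] : exists Q, Q \in S :\ P by apply/set0Pn; rewrite -card_gt0; lia.
have szQ := cardsD1 Q (S :\ P); rewrite SPQ add1n in szQ.
have neqPQ : P != Q by move: SPQ; rewrite !inE eq_sym => /andP[].
have [v v0 [vP vQ]] := line_through P Q.
have [/exists_inP[R SR vR] | /exists_inPn vS] :=
  boolP [exists (R | R \in S), evalp (lform v) R != 0]; last first.
  by exists v => // R /vS; rewrite negbK evalp_lform => /eqP.
have [m [m1 mQ mR mP]] := line_avoiding neqPQ (lform_homog v) vP vQ vR.
have SPQR : R \in S :\ P :\ Q.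
  by rewrite !inE SR andbT; apply/andP; split; apply: contraNneq vR => ->;
    rewrite ?vP ?vQ.
have szR := cardsD1 R (S :\ P :\ Q); rewrite SPQR add1n in szR.
have [|f [fh fS fP]] := @separating_form F P (enum (S :\ P :\ Q :\ R)).
  by rewrite mem_enum !inE eqxx !andbF.
move: fh; rewrite -cardE => fh.
suff /eqP: evalp (m * f) P = 0 by rewrite evalpM mulf_eq0 (negPf mP) (negPf fP).
apply: dual_isolated_degree_q_minus_2 dc _ SP _.
  have -> : (q - 2 = 1 + #|S :\ P :\ Q :\ R|)%N by lia.
  exact: dhomogM.
move=> T ST neqTP; rewrite evalpM.
have [->|neqTQ] := eqVneq T Q; first by rewrite mQ mul0r.
have [->|neqTR] := eqVneq T R; first by rewrite mR mul0r.
by rewrite fS ?mulr0 // mem_enum !inE neqTR neqTQ neqTP.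
Qed.

(** If the line of the support missed [P0], the [q - 1] lines joining [P0] to
    the points of the support other than [P] would miss [P], and their product
    vanishes at [P0] to order [q - 1 >= b]. *)
Lemma support_collinear_P0 c : dual c -> weight c = q -> (b <= q - 1)%N ->
  collinear (P0 F |: code_support c).
Proof.
move=> dc wc bq1; have [v v0 vS] := support_collinear dc wc.
rewrite weight_support in wc; set S := code_support c in wc vS *.
have vS0 R : R \in S -> evalp (lform v) R = 0.
  by rewrite evalp_lform; apply: vS.
have [vP0|vP0] := eqVneq (evalp (lform v) (P0 F)) 0.
  exists v => // R; rewrite in_setU1 -evalp_lform => /orP[/eqP->//|].
  exact: vS0.
have [P SP] : exists P, P \in S by apply/set0Pn; rewrite -card_gt0 wc; lia.
have szP := cardsD1 P S; rewrite SP wc add1n in szP.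
have szE : size (enum (S :\ P)) = (q - 1)%N.
  by apply/eq_add_S; rewrite -cardE -szP; lia.
have [Q|f [fh fS fP fI]] := @separating_cone F P (P0 F) (enum (S :\ P)).
  rewrite mem_enum !inE eq_sym => /andP[neqPQ SQ].
  exact: line_avoiding neqPQ (lform_homog v) (vS0 P SP) (vS0 Q SQ) vP0.
case/eqP: fP; apply: dual_isolated dc _ _ SP _.
- by rewrite -szE.
- by apply/ideal_pow_vanishes_on/fI; rewrite szE.
- by move=> T ST neqTP; rewrite fS // mem_enum !inE neqTP.
Qed.

(** Forms of the code restrict to the line [x = y] through [P0] as polynomials
    of degree at most [q - 1] without constant term; these form a space of
    dimension [q - 1], hence are dependent on the [q] other points of the curve
    on that line. *)
Lemma dual_word_on_secant : prime_power q -> #|F| = (q ^ 2)%N ->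
  exists c, [/\ dual c, c != 0 & (weight c <= q)%N].
Proof.
move=> q_pp cardF.
have [s [s_uniq s_size s_root]] := trace_one_roots q_pp cardF.
have s_neq0 u : u \in s -> u != 0.
  move/s_root; apply: contra_eq_neq => ->.
  by rewrite addr0 expr0n; case: (q) q2 => // k _; rewrite eq_sym oner_neq0.
(* The nonzero solutions of [x ^ q + x = x ^ (q + 1)] are the inverses of
   the roots of [u ^ q + u = 1]. *)
pose x (j : 'I_q) := (s`_j)^-1; pose pt j := diag_pt (x j).
have s_mem (j : 'I_q) : s`_j \in s by rewrite mem_nth ?s_size.
have pt_inj : injective pt.
  move=> j j' /diag_pt_inj/invr_inj/eqP.
  by rewrite nth_uniq ?s_size // => /eqP/val_inj.
have ptB j : pt j \in B.
  rewrite !inE negb_or -andbA; apply/and3P; split.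
  - apply/eqP => /(congr1 (fun P : ppoint F => pcoord P 0 iz)).
    by rewrite !mxE !xyz_neq eqxx => /eqP; rewrite oner_eq0.
  - by rewrite -diag_pt0 (inj_eq (@diag_pt_inj F)) invr_eq0 s_neq0.
  - rewrite /onX evalp_hermitian !mxE !xyz_neq eqxx expr1n !mulr1 exprS.
    have sj0 := s_neq0 _ (s_mem j); have sjq0 := expf_neq0 q sj0.
    move: (s_root _ (s_mem j)); rewrite /x !exprVn.
    move: (s`_j) (s`_j ^+ q) sj0 sjq0 => u v u0 v0 uv1; apply/eqP.
    have -> : v^-1 + u^-1 - u^-1 * v^-1 = (v + u - 1) / (u * v).
      by field; rewrite u0 v0.
    by rewrite uv1 subrr mul0r.
(* Only the exponents [1, ..., q - 1] are imposed: the constant term vanishes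
   for the forms of the code. *)
have [|a a0 aA] := @left_kernel_nontrivial F q (q - 1)
  (\matrix_(j, e) x j ^+ e.+1); first by lia.
have a_ortho e : (e < q - 1)%N -> \sum_j a 0 j * x j ^+ e.+1 = 0.
  move=> lt_e; move: (congr1 (fun M : 'rV_(q - 1) => M 0 (Ordinal lt_e)) aA).
  by rewrite !mxE => E; rewrite -[RHS]E; apply: eq_bigr => j _; rewrite mxE.
pose w P := \sum_(j | pt j == P) a 0 j; pose c : 'rV[F]_#|B| :=
  \row_i w (enum_val i).
have wpt j : w (pt j) = a 0 j.
  rewrite /w (bigD1 j) //= big1 ?addr0 // => j' /andP[/eqP/pt_inj->].
  by rewrite eqxx.
exists c; split.
- move=> _ [f [fh _ fb ->]].
  have f0 : evalp f (P0 F) = 0.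
    apply: vanishes_on_eval b0 _ fb; apply/eqP.
    by rewrite -diag_pt0 evalp_hermitian !mxE !xyz_neq eqxx expr1n !mulr1 addr0
      exprS mul0r subr0 expr0n; case: (q) q2.
  have [p size_p pE] := evalp_diag fh.
  have p0 : p`_0 = 0 by rewrite -horner_coef0 -pE diag_pt0.
  transitivity (\sum_(P in B) w P * evalp f P).
    by rewrite [RHS]big_enum_val; apply: eq_bigr => i _; rewrite !mxE.
  transitivity (\sum_j a 0 j * p.[x j]).
    under eq_bigr => P _ do rewrite /w mulr_suml.
    rewrite (exchange_big_dep predT) //=; apply: eq_bigr => j _.
    rewrite (bigD1 (pt j)) ?ptB ?eqxx //= big1 ?addr0 ?pE // => P.
    by case/andP=> /andP[_ /eqP->]; rewrite eqxx.
  under eq_bigr => j _ do rewrite (horner_coef_wide _ size_p) mulr_sumr.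
  rewrite exchange_big /= big1 // => -[[|e] /= lt_e] _.
    by rewrite big1 // => j _; rewrite p0 mul0r mulr0.
  under eq_bigr => j _ do rewrite mulrCA.
  by rewrite -mulr_sumr a_ortho ?mulr0.
- have /rV0Pn[j aj] := a0; apply/rV0Pn.
  by exists (enum_rank_in (ptB j) (pt j)); rewrite mxE enum_rankK_in // wpt.
- rewrite weight_support -[leqRHS]card_ord.
  apply: leq_trans (leq_image_card pt 'I_q).
  apply/subset_leq_card/subsetP => P /code_supportP[i -> ]; rewrite mxE /w.
  apply: contraR => nP; rewrite big_pred0 // => j; apply: contraNF nP => /eqP<-.
  exact: image_f.
Qed.

End DualCode.

Theorem theorem24 (F : finFieldType) (q b : nat)
  (hq : prime_power q) (hF : #|F| = (q ^ 2)%N) (hq2 : (2 < q - 1)%N)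
  (hb : (1 <= b <= q)%N)
  (hG3_degree :
     q%:Z ^+ 2 - q%:Z - 2%:Z <= (q%:Z - 1) * (q%:Z + 1) - b%:Z
       <= (q%:Z ^+ 2 - q%:Z - 2%:Z) + q%:Z)
  (hG3_equiv :
     let D : {freeg ppoint (Fbar F)} :=
       << ((q%:Z - 1) * (q%:Z + 1)) *g Pinf (Fbar F) >>
         - << b%:Z *g P0 (Fbar F) >> in
     (exists n : int, lin_equiv q D << n *g Pinf (Fbar F) >>) \/
     (exists n : int, lin_equiv q D << n *g P0 (Fbar F) >>)) :
  is_min_distance (dual_code (@hermitian_code F q (q - 1) 0 b)) q /\
  (forall c : 'rV[F]_#|Bset F q|,
     min_weight_codeword (dual_code (@hermitian_code F q (q - 1) 0 b)) c ->
     collinear (code_support c) /\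
     ((b <= q - 1)%N -> collinear (P0 F |: code_support c))).
Proof.
case/andP: hb => b0 bq.
have distE (c c' : 'rV[F]_#|Bset F q|) : hamming_dist c c' = weight (c - c').
  by apply: eq_card => i; rewrite !inE !mxE subr_eq0.
have [w [dw w0 w_le]] := dual_word_on_secant hq2 b0 bq hq hF.
have wE : weight w = q.
  by apply/eqP; rewrite eqn_leq w_le (dual_weight_ge hq2 b0 bq).
split; first split.
- exists w, 0; split=> //; last by rewrite distE subr0.
  by move=> v _; rewrite big1 // => i _; rewrite mxE mul0r.
- move=> c c' dc dc' neq_cc'; rewrite distE.
  by apply: (dual_weight_ge hq2 b0 bq); [apply: dual_sub | rewrite subr_eq0].
move=> c [dc c0 c_min].
have cE : weight c = q.
  by apply/eqP; rewrite eqn_leq (dual_weight_ge hq2 b0 bq) // -{2}wE c_min.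
split; first exact: (support_collinear hq2 b0 bq).
exact: (support_collinear_P0 hq2 b0 bq).
Qed.
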